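(* Let $\mathcal{H}(\omega^* )$ be the group of all self-homeomorphisms of $\omega^* = \beta\omega \setminus \omega$, endowed with the compact-open topology, and let $\sigma \in \mathcal{H}(\omega^* )$ be the shift map. Then the isomorphism classes of $\sigma$ and $\sigma^{-1}$ cannot be separated by a Borel set in $\mathcal{H}(\omega^* )$; that is, there is no Borel set $B \subseteq \mathcal{H}(\omega^* )$ that contains one of the two isomorphism classes and is disjoint from the other.
   Context: $\omega^* = \beta\omega\setminus\omega$ is the space of non-principal ultrafilters on $\omega$ (the Stone space of $\mathcal{P}(\omega)/\mathrm{fin}$). The shift map $\sigma:\omega^*\to\omega^*$ sends an ultrafilter $u$ to the unique ultrafilter generated by $\{A+1 : A\in u\}$; equivalently it is the restriction to $\omega^*$ of the continuous extension $\beta\omega\to\beta\omega$ of the successor function $n\mapsto n+1$. The compact-open topology on $\mathcal{H}(\omega^* )$ is generated by the sets $\{h \in \mathcal{H}(\omega^* ): h[K]\subseteq U\}$ with $K\subseteq\omega^*$ compact and $U\subseteq\omega^*$ open. Two maps $f,g\in\mathcal{H}(\omega^* )$ are isomorphic if there is $h\in\mathcal{H}(\omega^* )$ with $h\circ f=g\circ h$; the isomorphism class of $f$ is the set of all $g \in \mathcal{H}(\omega^* )$ isomorphic to $f$. *)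

(* Defs.v *)
From HB Require Import structures.
From mathcomp Require Import all_boot monoid.
From mathcomp Require Import all_classical all_analysis.

Set Implicit Arguments.
Unset Strict Implicit.
Unset Printing Implicit Defensive.

Local Open Scope classical_set_scope.

(* Self-homeomorphisms of [X], with the subspace topology inherited from the
   compact-open topology on all maps [X -> X], and the group structure given by
   composition: [f * g] is [f \o g]. *)

Definition is_homeo (X : topologicalType) : set {compact-open, X -> X} :=
  [set f | exists g : X -> X,
    [/\ continuous (f : X -> X), continuous g, cancel f g & cancel g f]].

Definition homeo (X : topologicalType) : Type := set_type (@is_homeo X).

HB.instance Definition _ (X : topologicalType) :=
  Topological.copy (homeo X) (set_type (@is_homeo X)).

Definition homeo_fun {X : topologicalType} (f : homeo X) : X -> X := set_val f.
Coercion homeo_fun : homeo >-> Funclass.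

Section homeo_group.
Variable X : topologicalType.
Implicit Types f g h : homeo X.

Lemma homeoP f : is_homeo (f : X -> X).
Proof. exact: set_valP. Qed.

Lemma homeo_cvgP (F : set_system (homeo X)) h : Filter F ->
  F --> h <-> forall K O : set X, compact K -> open O -> h @` K `<=` O ->
    F [set g : homeo X | g @` K `<=` O].
Proof.
move=> FF; split=> [Fh K O cK oO hKO|Fh].
  apply: Fh; exists (homeo_fun @^-1` [set g | g @` K `<=` O]); split=> //.
  by exists [set g | g @` K `<=` O] => //; exact: compact_open_open.
move=> A [_ [[B oB <-] Bh] BA]; apply: filterS BA _.
have : nbhs (homeo_fun h : {compact-open, X -> X}) B.
  by apply: open_nbhs_nbhs.
move: B {oB Bh}; rewrite -[forall B, _]/(homeo_fun @ F --> _).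
by apply/compact_open_cvgP => K O cK oO hKO; exact: Fh.
Qed.

Lemma homeo_ext f g : f =1 g -> f = g.
Proof. by move=> fg; apply: val_inj; apply/funext. Qed.

Definition homeo_of (f g : X -> X) (cf : continuous f) (cg : continuous g)
    (fK : cancel f g) (gK : cancel g f) : homeo X :=
  exist _ (f : {compact-open, X -> X})
    (mem_set (ex_intro _ g (And4 cf cg fK gK))).

Lemma continuous_homeo f : continuous f.
Proof. by have [g []] := homeoP f. Qed.

Definition homeo_inv_fun f : X -> X := projT1 (cid (homeoP f)).

Lemma homeo_inv_funP f : [/\ continuous f, continuous (homeo_inv_fun f),
  cancel f (homeo_inv_fun f) & cancel (homeo_inv_fun f) f].
Proof. exact: (projT2 (cid (homeoP f))). Qed.

Lemma continuous_homeo_inv_fun f : continuous (homeo_inv_fun f).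
Proof. by have [] := homeo_inv_funP f. Qed.

Lemma homeo_funK f : cancel f (homeo_inv_fun f).
Proof. by have [] := homeo_inv_funP f. Qed.

Lemma homeo_inv_funK f : cancel (homeo_inv_fun f) f.
Proof. by have [] := homeo_inv_funP f. Qed.

Definition homeo_inv f : homeo X :=
  homeo_of (@continuous_homeo_inv_fun f) (@continuous_homeo f)
    (@homeo_inv_funK f) (@homeo_funK f).

Definition homeo_one : homeo X :=
  @homeo_of id id (fun _ => cvg_id) (fun _ => cvg_id)
    (fun _ => erefl) (fun _ => erefl).

Lemma continuous_homeo_comp f g : continuous (f \o g).
Proof.
by move=> x; apply: continuous_comp; exact: continuous_homeo.
Qed.

Lemma continuous_homeo_inv_comp f g :
  continuous (homeo_inv_fun g \o homeo_inv_fun f).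
Proof.
by move=> x; apply: continuous_comp; exact: continuous_homeo_inv_fun.
Qed.

Definition homeo_mul f g : homeo X :=
  homeo_of (@continuous_homeo_comp f g) (@continuous_homeo_inv_comp f g)
    (can_comp (@homeo_funK f) (@homeo_funK g))
    (can_comp (@homeo_inv_funK g) (@homeo_inv_funK f)).

Lemma homeo_mulA : associative homeo_mul.
Proof. by move=> f g h; apply: homeo_ext. Qed.

Lemma homeo_mul1 : left_id homeo_one homeo_mul.
Proof. by move=> f; apply: homeo_ext. Qed.

Lemma homeo_1mul : right_id homeo_one homeo_mul.
Proof. by move=> f; apply: homeo_ext. Qed.

Lemma homeo_mulV : left_inverse homeo_one homeo_inv homeo_mul.
Proof. by move=> f; apply: homeo_ext => x; exact: homeo_funK. Qed.

Lemma homeo_Vmul : right_inverse homeo_one homeo_inv homeo_mul.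
Proof. by move=> f; apply: homeo_ext => x; exact: homeo_inv_funK. Qed.

End homeo_group.

HB.instance Definition _ (X : topologicalType) := isGroup.Build (homeo X)
  (@homeo_mulA X) (@homeo_mul1 X) (@homeo_1mul X) (@homeo_mulV X)
  (@homeo_Vmul X).

Definition isomorphic (X : topologicalType) (f g : homeo X) : Prop :=
  exists h : homeo X, h \o f = g \o h.

Definition iso_class (X : topologicalType) (f : homeo X) : set (homeo X) :=
  [set g | isomorphic f g].

Definition Borel (T : topologicalType) : set_system T := <<s @open T >>.

(* The Cech-Stone compactification of the discrete space [nat]: the sets
   [{u | A \in u}] form a base of its topology. *)

Definition beta_omega : Type := [set u : set_system nat | UltraFilter u].

Definition ultra_sets (u : beta_omega) : set nat -> Prop := set_val u.
Coercion ultra_sets : beta_omega >-> Funclass.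

Lemma ultra_setsP (u : beta_omega) : UltraFilter (ultra_sets u).
Proof. exact: (set_valP u). Qed.

HB.instance Definition _ := Choice.on beta_omega.

Definition stone_set (A : set nat) : set beta_omega :=
  [set u : beta_omega | u A].

Lemma stone_cover : \bigcup_(A in [set: set nat]) stone_set A = setT.
Proof.
apply/seteqP; split=> // u _; exists setT => //=.
by have uU := ultra_setsP u; exact: filterT.
Qed.

Lemma stone_join (A B : set nat) (u : beta_omega) :
  [set: set nat] A -> [set: set nat] B -> stone_set A u -> stone_set B u ->
  exists C, [/\ [set: set nat] C, stone_set C u &
    stone_set C `<=` stone_set A `&` stone_set B].
Proof.
move=> _ _ uA uB; have uU := ultra_setsP u.
exists (A `&` B); split => //; first exact: filterI.
move=> v vAB; have vU := ultra_setsP v.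
by split; move: vAB; apply: filterS => ? [].
Qed.

HB.instance Definition _ :=
  isBaseTopological.Build beta_omega stone_cover stone_join.

Definition principal_ultra (n : nat) : beta_omega :=
  exist _ (principal_filter n) (mem_set (principal_filter_ultra n)).

Definition omega_star_set : set beta_omega := ~` range principal_ultra.

Definition omega_star : Type := set_type omega_star_set.

HB.instance Definition _ :=
  Topological.copy omega_star (set_type omega_star_set).

Definition omega_star_val (u : omega_star) : beta_omega := set_val u.
Coercion omega_star_val : omega_star >-> beta_omega.

(* [shift_filter u] is the filter generated by [{A + 1 | A \in u}], and
   [unshift_filter u] the filter generated by [{A - 1 | A \in u}]; the latter is
   only needed to see that the shift is a homeomorphism. *)

Definition shift_filter (u : omega_star) : set_system nat :=
  filter_from (ultra_sets u) (fun A => succn @` A).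

Definition unshift_filter (u : omega_star) : set_system nat :=
  filter_from (ultra_sets u) (fun A => succn @^-1` A).

Section shift.
Implicit Types u v : omega_star.

Lemma ultra_setC (F : set_system nat) (A : set nat) :
  UltraFilter F -> ~ F A -> F (~` A).
Proof. by move=> FU; have [] := in_ultra_setVsetC A FU. Qed.

Lemma ultra_of (F : set_system nat) : ProperFilter F ->
  (forall A, F A \/ F (~` A)) -> UltraFilter F.
Proof.
move=> FF FC; split=> // G GF FG; apply/seteqP; split=> // A GA.
have [//|/FG GnA] := FC A.
by have [x []] := filter_ex (filterI GA GnA).
Qed.

Lemma omega_star_ultra u : UltraFilter (ultra_sets u).
Proof. exact: ultra_setsP. Qed.

Lemma omega_star_meet u A B : u A -> u B -> A `&` B !=set0.
Proof.
have uU := omega_star_ultra u; move=> uA uB.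
by apply: (@filter_ex _ (ultra_sets u)); exact: filterI.
Qed.

Lemma omega_star_eq (u v : omega_star) : ultra_sets u = ultra_sets v -> u = v.
Proof. by move=> uv; do 2 apply: val_inj. Qed.

Lemma omega_star_setD1 u (n : nat) : u (~` [set n]).
Proof.
have uU := omega_star_ultra u.
apply: ultra_setC => un; apply: (set_mem (valP u)); exists n => //.
apply: val_inj => /=; apply/esym; have := principal_filter_ultra n.
case=> _; apply=> A /principal_filterP An.
by apply: filterS un => _ ->.
Qed.

Lemma shift_filterE u A : shift_filter u A = u (succn @^-1` A).
Proof.
have uU := omega_star_ultra u; apply/propext; split.
  by case=> B uB BA; apply: filterS uB => n Bn; apply: BA; exists n.
by move=> uA; exists (succn @^-1` A) => // _ [n An <-].
Qed.

Lemma unshift_filterE u A : unshift_filter u A = u (succn @` A).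
Proof.
have uU := omega_star_ultra u; apply/propext; split.
  case=> B uB BA; apply: filterS (filterI uB (omega_star_setD1 u 0)).
  by move=> [[_ []//]|n [Bn _]]; exists n => //; exact: BA.
by move=> uA; exists (succn @` A) => // n [m Am [<-]].
Qed.

Lemma shift_ultra u : UltraFilter (shift_filter u).
Proof.
have uU := omega_star_ultra u; apply: ultra_of => [|A]; last first.
  by rewrite !shift_filterE preimage_setC; exact: in_ultra_setVsetC.
apply: Build_ProperFilter_ex => [A|].
  by rewrite shift_filterE => /filter_ex[n An]; exists n.+1.
split=> [|A B|A B AB]; rewrite !shift_filterE.
- exact: filterT.
- by move=> ? ?; exact: filterI.
- by apply: filterS => n; exact: AB.
Qed.

Lemma unshift_ultra u : UltraFilter (unshift_filter u).
Proof.
have uU := omega_star_ultra u; apply: ultra_of => [|A]; last first.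
  rewrite !unshift_filterE; have [|uA] := in_ultra_setVsetC (succn @` A) uU.
    by left.
  right; apply: filterS (filterI uA (omega_star_setD1 u 0)).
  move=> [[_ []//]|n [nA _]]; exists n => // An.
  by apply: nA; exists n.
apply: Build_ProperFilter_ex => [A|].
  by rewrite unshift_filterE => /filter_ex[_ [n An _]]; exists n.
split=> [|A B|A B AB]; rewrite !unshift_filterE.
- by apply: filterS (omega_star_setD1 u 0) => -[/(_ erefl)//|n _]; exists n.
- move=> uA uB; apply: filterS (filterI uA uB).
  by move=> _ [[n An <-] [m Bm [mn]]]; exists n => //; split; rewrite // -mn.
- by apply: filterS => _ [n /AB Bn <-]; exists n.
Qed.

Lemma shift_nonprincipal u :
  omega_star_set (exist _ (shift_filter u) (mem_set (shift_ultra u))).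
Proof.
case=> n _ /(congr1 (fun v : beta_omega => v [set n])) /= E.
have : shift_filter u [set n].
  have <- : principal_filter n [set n] = shift_filter u [set n] := E.
  exact/principal_filterP.
rewrite shift_filterE => un.
have [m [/= mn]] := omega_star_meet un (omega_star_setD1 u n.-1).
by apply; rewrite -mn.
Qed.

Lemma unshift_nonprincipal u :
  omega_star_set (exist _ (unshift_filter u) (mem_set (unshift_ultra u))).
Proof.
case=> n _ /(congr1 (fun v : beta_omega => v [set n])) /= E.
have : unshift_filter u [set n].
  have <- : principal_filter n [set n] = unshift_filter u [set n] := E.
  exact/principal_filterP.
rewrite unshift_filterE image_set1 => un.
by have [m [/= mn]] := omega_star_meet un (omega_star_setD1 u n.+1).
Qed.

Definition shift_fun u : omega_star :=
  exist _ (exist _ (shift_filter u) (mem_set (shift_ultra u)))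
    (mem_set (@shift_nonprincipal u)).

Definition unshift_fun u : omega_star :=
  exist _ (exist _ (unshift_filter u) (mem_set (unshift_ultra u)))
    (mem_set (@unshift_nonprincipal u)).

Lemma shift_funK : cancel shift_fun unshift_fun.
Proof.
move=> u; apply: omega_star_eq; apply/funext => A.
rewrite -[LHS]/(unshift_filter (shift_fun u) A) unshift_filterE.
rewrite -[LHS]/(shift_filter u _) shift_filterE.
by congr (ultra_sets _ _); apply/seteqP; split=> [n [m Am [<-]]//|n An];
  exists n.
Qed.

Lemma unshift_funK : cancel unshift_fun shift_fun.
Proof.
move=> u; apply: omega_star_eq; apply/funext => A.
rewrite -[LHS]/(shift_filter (unshift_fun u) A) shift_filterE.
rewrite -[LHS]/(unshift_filter u _) unshift_filterE.
have uU := omega_star_ultra u; apply/propext; split.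
  by apply: filterS => _ [n An <-].
move=> uA; apply: filterS (filterI uA (omega_star_setD1 u 0)).
by move=> [[_ []//]|n [An _]]; exists n.
Qed.

Lemma open_stone_set A : open (stone_set A).
Proof. by exists [set A] => //; rewrite bigcup_set1. Qed.

Lemma omega_star_continuous (f : omega_star -> omega_star)
    (p : set nat -> set nat) :
  (forall u A, f u A = u (p A)) -> continuous f.
Proof.
move=> fp; apply/continuousP => _ [V [D _ <-] <-].
exists (\bigcup_(A in D) stone_set (p A)).
  by apply: bigcup_open => A _; exact: open_stone_set.
have fpE u A : stone_set (p A) (omega_star_val u) <-> stone_set A (f u).
  by rewrite /stone_set /= fp.
apply/seteqP; split=> u [A DA uA]; exists A => //.
- exact: (fpE u A).1 uA.
- exact: (fpE u A).2 uA.
Qed.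

Lemma continuous_shift_fun : continuous shift_fun.
Proof. by apply: omega_star_continuous => u A; exact: shift_filterE. Qed.

Lemma continuous_unshift_fun : continuous unshift_fun.
Proof. by apply: omega_star_continuous => u A; exact: unshift_filterE. Qed.

End shift.

Definition sigma : homeo omega_star :=
  homeo_of continuous_shift_fun continuous_unshift_fun shift_funK unshift_funK.

(* Main.v *)
(** A condition is a countable list of constraints [g[A_i*] `<=` B_i*]. Every
    member [g] of either class is incompressible: a nonempty clopen set mapped
    into itself by [g] is everything. Hence, when finitely many constraints are
    met by such a [g], the finite digraph they induce on the cells of [nat] cut
    out by the [A_i] and [B_i] is strongly connected. If this holds for every
    finite part of a condition, a walk passing to finer and finer cells
    enumerates [nat] bijectively so that successive points obey each constraint
    from some time on; conjugating [sigma] by this enumeration gives a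
    homeomorphism meeting the whole condition, and walking backwards does the
    same for [sigma^-1]. So conditions are closed under countable limits, and
    each consistent condition is met in both classes. As in a Baire category
    argument, every Borel set is decided, on the union of the two classes, by a
    dense set of conditions, and therefore cannot separate them. *)

From mathcomp Require Import all_boot monoid.
From mathcomp Require Import all_classical all_analysis.
Require Import Defs.

Set Implicit Arguments.
Unset Strict Implicit.
Unset Printing Implicit Defensive.

Local Open Scope classical_set_scope.

(** * Compactness and clopen subsets of [omega_star] *)

Lemma compact_finite_cover (T : topologicalType) (I : eqType) (K : set T)
    (f : I -> set T) : compact K ->
  (forall x, K x -> exists i, nbhs x (f i)) ->
  exists s : seq I, forall x, K x -> exists2 i, i \in s & f i x.
Proof.
move=> cK fK; apply: contrapT => Ns.
pose G (s : seq I) := K `&` [set x | forall i, i \in s -> ~ f i x].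
have GF : ProperFilter (filter_from setT G).
  apply: filter_from_proper => [|s _].
    apply: filter_from_filter; first by exists [::].
    move=> s t _ _; exists (s ++ t) => // x [Kx stx].
    by split; split=> // i si; apply: stx; rewrite mem_cat si ?orbT.
  apply: contrapT => sN; apply: Ns; exists s => x Kx; apply: contrapT => sx.
  by apply: sN; exists x; split=> // i si fx; apply: sx; exists i.
have [|x [Kx clx]] := cK _ GF; first by exists [::] => // x [].
have [i fx] := fK x Kx.
have [|y [[_ +] fy]] := clx (G [:: i]) (f i) _ fx; first by exists [:: i].
by apply; rewrite ?inE //; exact: fy.
Qed.

Lemma omega_star_notP (u : omega_star) A : ~ u A <-> u (~` A).
Proof.
have uU := omega_star_ultra u; split; first exact: ultra_setC.
by move=> uC uA; have [x []] := omega_star_meet uA uC.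
Qed.

Lemma omega_star_infinite (u : omega_star) A : u A -> infinite_set A.
Proof.
have uU := omega_star_ultra u.
move=> uA /finite_seqP[s sA]; rewrite {}sA in uA.
elim: s uA => [|n s IHs] uA.
  by have [x []] := omega_star_meet uA uA.
apply: IHs; apply: filterS (filterI uA (omega_star_setD1 u n)) => m /=.
by rewrite inE => -[/orP[/eqP|]].
Qed.

Lemma omega_star_of (F : set_system nat) : UltraFilter F ->
  (forall n, F (~` [set n])) -> exists u : omega_star, ultra_sets u = F.
Proof.
move=> FU Fn.
suff Fs : omega_star_set (exist _ F (mem_set FU)).
  by exists (exist _ (exist _ F (mem_set FU)) (mem_set Fs)).
case=> n _ /(congr1 (fun v : beta_omega => v [set n])) E.
have Fn1 : F [set n].
  have <- : principal_filter n [set n] = F [set n] := E.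
  exact/principal_filterP.
by have [x []] := filter_ex (filterI Fn1 (Fn n)).
Qed.

Lemma infinite_omega_star A : infinite_set A -> exists u : omega_star, u A.
Proof.
move=> iA; pose G (s : seq nat) := A `\` [set` s].
have GF : ProperFilter (filter_from setT G).
  apply: filter_from_proper => [|s _].
    apply: filter_from_filter; first by exists [::].
    move=> s t _ _; exists (s ++ t) => // x [Ax stx].
    by split; split=> // sx; apply: stx; rewrite /= mem_cat sx ?orbT.
  by apply: infinite_setN0; apply: infinite_setD => //; exact: finite_seq.
have [F [FU GFs]] := ultraFilterLemma GF.
have [n|u uF] := omega_star_of FU; last first.
  by exists u; rewrite uF; apply: GFs; exists [::] => // x [].
by apply: GFs; exists [:: n] => // x [_ nx] /= xn; apply: nx; rewrite xn /= inE.
Qed.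

Lemma nbhs_omega_star (u : omega_star) (O : set omega_star) :
  nbhs u O <-> exists2 A, u A & forall v : omega_star, v A -> O v.
Proof.
split=> [[_ [[_ [D _ <-] <-] [A DA uA] AO]]|[A uA AO]].
  by exists A => // v vA; apply: AO; exists A.
exists [set v : omega_star | v A]; split=> //.
by exists (stone_set A) => //; exact: open_stone_set.
Qed.

(** An ultrafilter [F] of points converges to the ultrafilter of those [A] that belong to [F]-almost
    every point. *)
Lemma compact_omega_star : compact [set: omega_star].
Proof.
rewrite compact_ultra => F FU _.
pose G : set_system nat := fun A => F [set u : omega_star | u A].
have GU : UltraFilter G.
  apply: ultra_of => [|A]; last first.
    have [?|FA] := in_ultra_setVsetC [set u : omega_star | u A] FU; [by left|].
    by right; apply: filterS FA => u /omega_star_notP.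
  apply: Build_ProperFilter_ex => [A|].
    rewrite /G => /filter_ex[u uA].
    by have [x []] := omega_star_meet uA uA; exists x.
  split=> [|A B GA GB|A B AB GA]; rewrite /G.
  - apply: filterS filterT => u _.
    by have uU := omega_star_ultra u; exact: filterT.
  - apply: filterS (@filterI _ F _ _ _ GA GB) => u [uA uB].
    by have uU := omega_star_ultra u; exact: filterI.
  - apply: (@filterS _ F _ _ _ _ GA) => u.
    by have uU := omega_star_ultra u; exact: filterS.
have [n|u uG] := omega_star_of GU.
  by rewrite /G; apply: filterS filterT => u _; exact: omega_star_setD1.
exists u; split=> // O /nbhs_omega_star[A uA AO].
by rewrite uG in uA; exact: (@filterS _ F _ _ _ AO uA).
Qed.

Lemma omega_star_cvg_nbhs (h : omega_star -> omega_star) : continuous h ->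
  forall u (A : set nat), h u A ->
    exists2 D, u D & forall v : omega_star, v D -> h v A.
Proof.
move=> hc u A huA; apply/(nbhs_omega_star u [set v | h v A]).
by apply: (hc u [set w : omega_star | w A]); apply/nbhs_omega_star; exists A.
Qed.

Lemma omega_star_all (I : eqType) (u : omega_star) (s : seq I)
    (f : I -> set nat) :
  (forall i, i \in s -> u (f i)) -> u [set n | forall i, i \in s -> f i n].
Proof.
have uU := omega_star_ultra u.
elim: s => [|i s IHs] uf; first by apply: filterS filterT.
have us : u [set n | forall i, i \in s -> f i n].
  by apply: IHs => j js; apply: uf; rewrite inE js orbT.
apply: filterS (filterI (uf i (mem_head _ _)) us) => n [fin sn] j.
by rewrite inE => /orP[/eqP->//|]; exact: sn.
Qed.

(** The preimage of a clopen set is clopen, by compactness a finite union of basic sets, and so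
    coded by one set [S]. *)
Lemma continuous_preimage_set (h : omega_star -> omega_star) (A : set nat) :
  continuous h -> exists S : set nat, forall u : omega_star, u S <-> h u A.
Proof.
move=> hc.
pose f (D : set nat) := [set u : omega_star | u D /\
  ((forall v : omega_star, v D -> h v A) \/
   (forall v : omega_star, v D -> ~ h v A))].
have [x _|s sP] := compact_finite_cover (f := f) compact_omega_star.
  have [xA|/omega_star_notP xA] := pselect (h x A).
    have [D xD DA] := omega_star_cvg_nbhs hc xA.
    by exists D; apply/nbhs_omega_star; exists D => // v vD; split=> //; left.
  have [D xD DA] := omega_star_cvg_nbhs hc xA.
  exists D; apply/nbhs_omega_star; exists D => // v vD; split=> //; right.
  by move=> w /DA/omega_star_notP.
pose Q D := D \in s /\ forall v : omega_star, v D -> h v A.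
exists (\bigcup_(D in Q) D) => u; have uU := omega_star_ultra u; split.
  apply: contraPP => hA; apply/omega_star_notP.
  have : u [set n | forall D, D \in s -> (Q D -> ~ D n)].
    apply: omega_star_all => D Ds.
    have [uD|/omega_star_notP] := pselect (u D).
      by apply: filterS filterT => n _ [_ /(_ u uD)/hA].
    by apply: filterS => n nD _.
  by apply: filterS => n sn [D QD Dn]; exact: sn QD.1 QD Dn.
move=> hA; have [D Ds [uD [DA|/(_ u uD)//]]] := sP u I.
by apply: filterS uD => n Dn; exists D.
Qed.

(** * Incompressibility of the two classes *)

Definition incompressible (f : omega_star -> omega_star) : Prop :=
  forall R : set nat, (exists u : omega_star, u R) ->
    (forall u : omega_star, u R -> f u R) -> forall u : omega_star, u R.

(** The set [D] of points leaving [R] is finite, as an ultrafilter on it would violate invariance;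
    an infinite [R] eventually closed under successor is cofinite. *)
Lemma incompressible_shift : incompressible shift_fun.
Proof.
move=> R [u uR] fR v; apply: contrapT => /omega_star_notP vR.
pose D := R `\` succn @^-1` R.
have [w wD] : exists w : omega_star, w D.
  apply: infinite_omega_star => /finite_seqP[s Ds].
  have sub n : \max_(i <- s) i < n -> R n -> R n.+1.
    move=> sn Rn; apply: contrapT => RSn.
    have : [set` s] n by rewrite -Ds.
    move=> /= ns; have := leq_bigmax_seq (P := xpredT) (F := id) n ns isT.
    by rewrite leqNgt sn.
  have [n [Rn sn]] : exists n, R n /\ \max_(i <- s) i < n.
    apply: contrapT => N.
    apply: (omega_star_infinite uR).
    apply: sub_finite_set (finite_II (\max_(i <- s) i).+1) => n Rn /=.
    by rewrite ltnS leqNgt; apply/negP => sn; apply: N; exists n.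
  apply: (omega_star_infinite vR).
  apply: sub_finite_set (finite_II n) => m /= Rm.
  rewrite ltnNge; apply/negP => nm; apply: Rm.
  elim: m nm => [|m IHm]; first by rewrite leqn0 => /eqP<-.
  rewrite leq_eqVlt => /orP[/eqP<-//|]; rewrite ltnS => nm.
  by apply: sub (IHm nm); exact: leq_trans nm.
have wU := omega_star_ultra w.
have wR : w R by apply: filterS wD => n [].
have := fR w wR.
rewrite -[shift_fun w R]/(shift_filter w R) shift_filterE => wS.
by have [n [[_ /= nR] Rn]] := omega_star_meet wD wS.
Qed.

(** If [g] maps a clopen set into itself, [f] maps its complement into itself, since
    [g (f w) = w]. *)
Lemma incompressible_can (f g : omega_star -> omega_star) :
  cancel f g -> incompressible f -> incompressible g.
Proof.
move=> fK fI R [u uR] gR v; apply: contrapT => /omega_star_notP vR.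
suff /omega_star_notP : u (~` R) by [].
apply: fI; first by exists v.
by move=> w /omega_star_notP wR; apply/omega_star_notP => /gR; rewrite fK.
Qed.

Lemma incompressible_isomorphic (f g : homeo omega_star) :
  isomorphic f g -> incompressible f -> incompressible g.
Proof.
move=> [h hfg] fI R [u uR] gR v.
have [S SP] := continuous_preimage_set R (@continuous_homeo _ h).
rewrite -(homeo_inv_funK h v); apply/SP; apply: fI => [|w /SP hwR].
  by exists (homeo_inv_fun h u); apply/SP; rewrite homeo_inv_funK.
apply/SP; have -> : h (f w) = g (h w) := congr1 (@^~ w) hfg.
exact: gR.
Qed.

Definition shift_classes : set (homeo omega_star) :=
  iso_class sigma `|` iso_class (sigma^-1)%g.

Lemma sigmaK : cancel sigma ((sigma^-1)%g : homeo omega_star).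
Proof. exact: homeo_funK. Qed.

Lemma sigma_invK : cancel ((sigma^-1)%g : homeo omega_star) sigma.
Proof. exact: homeo_inv_funK. Qed.

Lemma shift_classes_incompressible (g : homeo omega_star) :
  shift_classes g -> incompressible g.
Proof.
case=> /incompressible_isomorphic; apply; first exact: incompressible_shift.
exact: incompressible_can sigmaK incompressible_shift.
Qed.

(** * Finite constraints and strong connectivity of the cells *)

Definition maps_star (g : omega_star -> omega_star) (c : set nat * set nat) :=
  forall u : omega_star, u c.1 -> g u c.2.

(* As far as the constraints [p 0], ..., [p n.-1] can tell, a point in the cell
   of [x] may be mapped into the cell of [y]. *)
Definition step (p : nat -> set nat * set nat) (n x y : nat) : bool :=
  [forall i : 'I_n, `[< (p i).1 x -> (p i).2 y >]].

(** Equal colours mean the same cell of the partition generated by the first [n] pairs; the finite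
    codomain leaves finitely many cells. *)
Definition colour (p : nat -> set nat * set nat) (n x : nat) :
    {ffun 'I_n -> bool * bool} :=
  [ffun i : 'I_n => (`[< (p i).1 x >], `[< (p i).2 x >])].

Lemma stepP p n x y :
  reflect (forall i, i < n -> (p i).1 x -> (p i).2 y) (step p n x y).
Proof.
apply: (iffP forallP) => [pxy i lt_in|pxy i]; last exact/asboolP/pxy.
exact/asboolP/(pxy (Ordinal lt_in)).
Qed.

Lemma colour1 p n x x' i : i < n -> colour p n x = colour p n x' ->
  (p i).1 x <-> (p i).1 x'.
Proof.
move=> lt_in /ffunP/(_ (Ordinal lt_in)); rewrite !ffunE => -[E _].
by split=> /asboolP; rewrite (E, esym E) => /asboolP.
Qed.

Lemma colour2 p n x x' i : i < n -> colour p n x = colour p n x' ->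
  (p i).2 x <-> (p i).2 x'.
Proof.
move=> lt_in /ffunP/(_ (Ordinal lt_in)); rewrite !ffunE => -[_ E].
by split=> /asboolP; rewrite (E, esym E) => /asboolP.
Qed.

Definition fibre (T : Type) (c : nat -> T) (x : nat) := [set y | c y = c x].

Lemma finite_small_fibres (T : finType) (c : nat -> T) :
  finite_set [set x | finite_set (fibre c x)].
Proof.
pose D := [set t : T | finite_set (c @^-1` [set t])].
apply: (@sub_finite_set _ _ (\bigcup_(t in D) c @^-1` [set t])).
  by move=> x /= fx; exists (c x).
by apply: bigcup_finite => //; exact: finite_finset.
Qed.

Lemma omega_star_fibre (T : finType) (c : nat -> T) (u : omega_star) :
  exists2 x, infinite_set (fibre c x) & u (fibre c x).
Proof.
have uU := omega_star_ultra u.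
suff [x ux] : exists x, u (fibre c x).
  by exists x => //; exact: omega_star_infinite ux.
apply: contrapT => N.
have : u [set n | forall t, t \in enum T -> c n <> t].
  apply: omega_star_all => t _.
  apply/(omega_star_notP u (c @^-1` [set t])) => uft.
  have [x [xt _]] := omega_star_meet uft uft.
  by apply: N; exists x; apply: filterS uft => n; rewrite /fibre /= xt.
by move=> /filter_ex[n /(_ (c n))]; apply; rewrite ?mem_enum.
Qed.

(** Walks with at least one edge; [P] restricts every vertex except the first. *)
Inductive reach (e : rel nat) (P : set nat) : nat -> nat -> Prop :=
| reach1 x y : P y -> e x y -> reach e P x y
| reachS x y z : P y -> e x y -> reach e P y z -> reach e P x z.

Lemma reach_rcons e P x y z : reach e P x y -> P z -> e y z -> reach e P x z.
Proof.
elim=> {x y} [x y Py exy|x y w Py exy _ IH] Pz eyz.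
  by apply: reachS exy _ => //; exact: reach1.
by apply: reachS exy _ => //; exact: IH.
Qed.

Lemma reach_rev (e : rel nat) P x y : P x ->
  reach e P x y -> reach (fun a b => e b a) P y x.
Proof.
move=> + xy; elim: xy => {x y} [x y Py exy|x y w Py exy _ IH] Px.
  exact: reach1.
by apply: reach_rcons (IH Py) _ _.
Qed.

Definition good (p : nat -> set nat * set nat) n : set nat :=
  [set x | infinite_set (fibre (colour p n) x)].

(** If [u] lives on one cell and [g u] on another, all steps from the first to the second are
    allowed. Hence [g] maps the set [R] of good points reachable from [x] into itself, and by
    incompressibility [R] meets every infinite cell. *)
Lemma step_reach (p : nat -> set nat * set nat) (n : nat)
    (g : omega_star -> omega_star) : incompressible g ->
  (forall i, i < n -> maps_star g (p i)) ->
  forall x y, good p n x -> good p n y -> reach (step p n) (good p n) x y.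
Proof.
move=> gI gp x y gx gy.
pose R := [set z | good p n z /\ reach (step p n) (good p n) x z].
have gooda a b : colour p n a = colour p n b -> good p n a -> good p n b.
  by rewrite /good /fibre /= => ->.
have stepu (u : omega_star) a b : u (fibre (colour p n) a) ->
    g u (fibre (colour p n) b) ->
    forall a' b', fibre (colour p n) a a' -> fibre (colour p n) b b' ->
      step p n a' b'.
  move=> ua ub a' b' aa' bb'; apply/stepP => i lt_in Aa'.
  have uU := omega_star_ultra u.
  have /gp gB : u (p i).1.
    apply: filterS ua => a'' aa''.
    by apply/(colour1 lt_in (etrans aa'' (esym aa'))).
  have [c [bc Bc]] := omega_star_meet ub (gB lt_in).
  by apply/(colour2 lt_in (etrans bb' (esym bc))).
have [u ux] := infinite_omega_star gx.
have RS (v : omega_star) a : v (fibre (colour p n) a) ->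
    a = x \/ R a -> g v R.
  move=> va aR; have [b gb vb] := omega_star_fibre (colour p n) (g v).
  have gvU := omega_star_ultra (g v); apply: (filterS _ vb) => b' bb'.
  have gb' : good p n b' by exact: gooda (esym bb') gb.
  have sab := stepu v a b va vb a b' erefl bb'.
  split=> //; case: aR => [<-|[_ xa]]; first exact: reach1.
  exact: reach_rcons xa gb' sab.
have Rv : forall v : omega_star, v R.
  apply: gI; first by exists (g u); apply: (RS u x) => //; left.
  move=> v vR; have [a ga va] := omega_star_fibre (colour p n) v.
  have [b [Rb ab]] := omega_star_meet vR va.
  by apply: (RS v b); [rewrite /fibre ab|right].
have [v vy] := infinite_omega_star gy.
have [z [[gz xz] yz]] := omega_star_meet (Rv v) vy.
(* The walk ends at some [z] in the cell of [y]; its last step can be redirected to [y], since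
   [step] sees only cells. *)
have xy w : reach (step p n) (good p n) x w ->
    colour p n w = colour p n y -> reach (step p n) (good p n) x y.
  elim=> {w z gz xz yz gx ux RS Rv R} [a b _ sab|a b c gb sab _ IH] E.
    apply: reach1 => //; apply/stepP => i lt_in Aa.
    by apply/(colour2 lt_in E)/(stepP _ _ _ _ sab).
  by apply: reachS sab _ => //; exact: IH.
exact: xy xz yz.
Qed.

(** * Walks through fresh points, and the enumeration of [nat] they yield *)

Lemma fresh_path (T : Type) (c : nat -> T) (e : rel nat) (P : set nat) x y :
    (forall z, P z -> infinite_set (fibre c z)) ->
    (forall a a' b b', c a = c a' -> c b = c b' -> e a b -> e a' b') ->
  reach e P x y -> forall F : seq nat, exists t,
    [/\ path e x (rcons t y), uniq t & all [predC F] t].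
Proof.
move=> Pinf ec xy F.
(* The start must vary within its cell: replacing a vertex changes where the rest of the walk
   begins. *)
suff H x' : c x' = c x -> exists t,
    [/\ path e x' (rcons t y), uniq t & all [predC F] t] by exact: H.
elim: xy F x' => {x y} [x y Py exy|x y z Py exy _ IH] F x' xx'.
  by exists [::]; rewrite /= andbT; split=> //; exact: ec (esym xx') _ exy.
have : infinite_set (fibre c y `\` [set` F]).
  by apply: infinite_setD (finite_seq F); exact: Pinf.
move=> /infinite_setN0[y' [yy' y'F]].
have [t [pt ut Ft]] := IH (y' :: F) y' yy'.
exists (y' :: t); rewrite /= pt ut andbT; split.
- exact: ec (esym xx') (esym yy') exy.
- by apply/andP; split=> //; apply/negP => /(allP Ft); rewrite /= inE eqxx.
- rewrite (introN idP y'F) /=; apply: sub_all Ft => w /=.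
  by rewrite inE negb_or => /andP[].
Qed.

Section path_enumeration.
Variables (e : nat -> rel nat) (P : nat -> set nat).
Hypothesis e_mono : forall n x y, e n.+1 x y -> e n x y.
Hypothesis P_cofinite : forall n, finite_set (~` P n).
Hypothesis e_conn : forall n x y, P n x -> P n y -> forall F : seq nat,
  exists t, [/\ path (e n) x (rcons t y), uniq t & all [predC F] t].

Lemma path_to n x y (s : seq nat) : uniq s -> P n x -> P n y -> y \notin s ->
  exists t, path (e n) x (rcons t y) /\ uniq (s ++ rcons t y).
Proof.
move=> us Px Py ys; have [t [pt ut Ft]] := e_conn Px Py (y :: s).
exists t; split=> //; rewrite cat_uniq us rcons_uniq ut andbT has_rcons /=.
rewrite (negbTE ys) /= -all_predC; apply/andP; split.
  by apply: sub_all Ft => z /=; rewrite inE negb_or => /andP[].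
by apply/negP => /(allP Ft); rewrite /= inE eqxx.
Qed.

Lemma path_through n x (s L : seq nat) : uniq s -> P n x ->
    (forall y, y \in L -> P n y) ->
  exists t, [/\ path (e n) x t, uniq (s ++ t), P n (last x t) &
    {subset L <= s ++ t}].
Proof.
elim: L x s => [|y L IHL] x s us Px PL.
  by exists [::]; rewrite cats0; split.
have PL' z : z \in L -> P n z by move=> zL; apply: PL; rewrite inE zL orbT.
have [ys|ys] := boolP (y \in s).
  have [t [pt ut Pt Lt]] := IHL x s us Px PL'; exists t; split=> // z.
  by rewrite inE => /orP[/eqP->|/Lt//]; rewrite mem_cat ys.
have Py : P n y by apply: PL; rewrite mem_head.
have [t [pt ut]] := path_to us Px Py ys.
have [r [pr ur Pr Lr]] := IHL y _ ut Py PL'.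
exists (rcons t y ++ r); rewrite cat_path pt last_rcons catA last_cat last_rcons.
split=> // z; rewrite inE => /orP[/eqP->|/Lr//].
by rewrite !mem_cat mem_rcons mem_head /= orbT.
Qed.

(* Every point outside [P n] has been visited by stage [n], so that the points
   still to be visited can be reached along [e n]. *)
Let inv n (s : seq nat) :=
  [/\ uniq s, P n (last 0 s) & forall x, ~ P n x -> x \in s].

(** Visit [n] and the points outside [P n.+1]; those not yet visited lie in [P n] by the invariant.
    Then move to a new point of [P n] and [P n.+1], where the next stage can start. *)
Lemma path_extend n s : inv n s -> exists t,
  [/\ inv n.+1 (s ++ t), path (e n) (last 0 s) t, n \in s ++ t & 0 < size t].
Proof.
move=> [us Ps sP]; have [b bP] := (finite_seqP _).1 (P_cofinite n.+1).
have PL y : y \in [seq y <- n :: b | y \notin s] -> P n y.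
  rewrite mem_filter => /andP[/negP ys _]; apply: contrapT => /sP; exact: ys.
have [t [pt ut Pt Lt]] := path_through us Ps PL.
have [y [[Py Py'] yst]] : ((P n `&` P n.+1) `\` [set` s ++ t]) !=set0.
  apply: infinite_setN0; apply: infinite_setD (finite_seq _).
  apply: infinite_setIl (P_cofinite n.+1).
  by apply: cofinite_set_infinite (P_cofinite n); exact: infinite_nat.
have [r [pr ur]] := path_to ut Pt Py (introN idP yst).
have st x : x \in n :: b -> x \in s ++ t ++ rcons r y.
  move=> xb; rewrite catA mem_cat; have [xs|xs] := boolP (x \in s).
    by rewrite mem_cat xs.
  by rewrite Lt // mem_filter xs.
exists (t ++ rcons r y); split.
- split; rewrite ?catA // ?last_cat ?last_rcons // => x nPx; rewrite -catA.
  apply: st; rewrite inE; apply/orP; right.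
  by have : [set` b] x by rewrite -bP.
- by rewrite cat_path pt.
- by apply: st; rewrite mem_head.
- by rewrite size_cat size_rcons addnS.
Qed.

(** The lists [S n] extend one another without repetition and [S n.+1] contains [n], so their limit
    is bijective. *)
Lemma path_enumeration : exists m mi : nat -> nat, [/\ cancel m mi, cancel mi m &
  forall n, exists K, forall k, K <= k -> e n (m k) (m k.+1)].
Proof.
have /choice[f fP] : forall ns : nat * seq nat, exists t, inv ns.1 ns.2 ->
  [/\ inv ns.1.+1 (ns.2 ++ t), path (e ns.1) (last 0 ns.2) t,
      ns.1 \in ns.2 ++ t & 0 < size t].
  move=> [n s]; have [/path_extend[t tP]|ns] := pselect (inv n s).
    by exists t.
  by exists [::].
have [b bP] := (finite_seqP _).1 (P_cofinite 0).
have [y [Py yb]] : (P 0 `\` [set` b]) !=set0.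
  apply: infinite_setN0; apply: infinite_setD (finite_seq _).
  by apply: cofinite_set_infinite (P_cofinite 0); exact: infinite_nat.
(* The points outside [P 0] are listed first, in any order: edges matter only from the last entry
   [y] on. *)
pose S := fix S n := if n is n'.+1 then S n' ++ f (n', S n')
                     else rcons (undup b) y.
have SS n : S n.+1 = S n ++ f (n, S n) by [].
have Sinv n : inv n (S n).
  elim: n => [|n IHn]; last by rewrite SS; have [] := fP (n, S n) IHn.
  split=> [||x nPx] /=; first 1 last.
  - by rewrite last_rcons.
  - rewrite mem_rcons inE mem_undup; apply/orP; right.
    by have : [set` b] x by rewrite -bP.
  - by rewrite rcons_uniq undup_uniq mem_undup andbT; exact/negP.
have Ssize n : n < size (S n).
  elim: n => [|n IHn]; first by rewrite size_rcons.
  have [_ _ _] := fP (n, S n) (Sinv n).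
  by rewrite SS size_cat /= => ?; rewrite -addn1 leq_add.
have Smem n : n \in S n.+1 by have [] := fP (n, S n) (Sinv n).
have Spath n d : exists2 r, S (n + d) = S n ++ r & path (e n) (last 0 (S n)) r.
  elim: d => [|d [r Sr pr]]; first by exists [::]; rewrite // addn0 cats0.
  have [_ pf _ _] := fP (n + d, S (n + d)) (Sinv (n + d)).
  exists (r ++ f (n + d, S (n + d))); first by rewrite addnS SS catA -Sr.
  rewrite cat_path pr -last_cat -Sr; apply: sub_path pf => a c /=.
  by elim: d {r Sr pr} => [|d IHd]; rewrite ?addn0 // addnS => /e_mono.
pose m k := nth 0 (S k) k.
have mE N k : k < size (S N) -> m k = nth 0 (S N) k.
  rewrite /m => kN; have [kleN|/ltnW Nlek] := leqP k N.
    have [r + _] := Spath k (N - k); rewrite subnKC // => ->.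
    by rewrite nth_cat Ssize.
  have [r + _] := Spath N (k - N); rewrite subnKC // => ->.
  by rewrite nth_cat kN.
have minj : injective m.
  move=> j k; set N := maxn j k.
  have jN : j < size (S N) by apply: leq_ltn_trans (Ssize N); exact: leq_maxl.
  have kN : k < size (S N) by apply: leq_ltn_trans (Ssize N); exact: leq_maxr.
  have [uN _ _] := Sinv N.
  by rewrite (mE N) // (mE N k) // => /eqP; rewrite nth_uniq // => /eqP.
have mK : cancel (fun n => index n (S n.+1)) m.
  by move=> n; rewrite (mE n.+1) ?index_mem // nth_index.
exists m, (fun n => index n (S n.+1)); split=> //.
  by move=> k; apply: minj; rewrite mK.
(* This is the position of the last entry of [S n], where the walk along [e n] starts. *)
move=> n; exists (size (S n)).-1 => k.
have [r Sr pr] := Spath n k.+1.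
have kN : k.+1 < size (S (n + k.+1)).
  by apply: leq_ltn_trans (Ssize _); exact: leq_addl.
rewrite (mE _ _ kN) (mE _ _ (ltnW kN)); rewrite Sr in kN *.
case: (lastP (S n)) (Ssize n) pr kN => // s x _.
rewrite last_rcons size_rcons cat_rcons size_cat /= => pr kN sk.
rewrite !nth_cat ltnNge sk ltnNge (leqW sk) /= subSn //=.
by apply: (pathP 0 pr); rewrite ltn_subLR // -ltnS -addnS.
Qed.

End path_enumeration.

(** * Permutations of [nat] and conjugates of the shift *)

Section permutation_homeo.
Variables (m mi : nat -> nat).
Hypotheses (mK : cancel m mi) (miK : cancel mi m).

Lemma perm_omega_star (u : omega_star) :
  exists v : omega_star, forall A : set nat, v A <-> u (m @^-1` A).
Proof.
have uU := omega_star_ultra u.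
pose G : set_system nat := fun A => u (m @^-1` A).
have GU : UltraFilter G.
  by apply: ultra_of => A; exact: (in_ultra_setVsetC (m @^-1` A) uU).
have [n|v vG] := omega_star_of GU; last by exists v => A; rewrite vG.
rewrite /G; apply: filterS (omega_star_setD1 u (mi n)) => x /= xn mxn.
by apply: xn; rewrite -mxn mK.
Qed.

Definition perm_fun (u : omega_star) : omega_star :=
  projT1 (cid (perm_omega_star u)).

Lemma perm_funE (u : omega_star) (A : set nat) : perm_fun u A = u (m @^-1` A).
Proof. by apply/propext; rewrite /perm_fun; case: cid. Qed.

End permutation_homeo.

Lemma perm_funK m mi (mK : cancel m mi) (miK : cancel mi m) :
  cancel (perm_fun mK) (perm_fun miK).
Proof.
move=> u; apply: omega_star_eq; apply/funext => A; rewrite !perm_funE.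
by congr (ultra_sets _ _); apply/funext => x; rewrite /preimage /= mK.
Qed.

Definition perm_homeo m mi (mK : cancel m mi) (miK : cancel mi m) :
    homeo omega_star :=
  homeo_of (omega_star_continuous (perm_funE mK))
    (omega_star_continuous (perm_funE miK)) (perm_funK mK miK)
    (perm_funK miK mK).

Definition conj_homeo (f h : homeo omega_star) : homeo omega_star :=
  (h * f * h^-1)%g.

Lemma conj_homeoE f h u : conj_homeo f h (h u) = h (f u).
Proof. by rewrite -[LHS]/(h (f (homeo_inv_fun h (h u)))) homeo_funK. Qed.

Lemma isomorphic_conj f h : isomorphic f (conj_homeo f h).
Proof. by exists h; apply/funext => u /=; rewrite conj_homeoE. Qed.

Lemma omega_star_eventually (u : omega_star) (A : set nat) K :
  (forall k, K <= k -> A k) -> u A.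
Proof.
move=> AK; apply: contrapT => /omega_star_notP /omega_star_infinite; apply.
apply: sub_finite_set (finite_II K) => k /= nAk.
by rewrite ltnNge; apply/negP => /AK.
Qed.

(** Conjugation turns the constraint [c] into its preimage under [m], a constraint on [f]. The
    relation [d] will be successor for [sigma] and its converse for the inverse. *)
Lemma maps_star_conj_perm (f : homeo omega_star) (d : nat -> nat -> Prop)
    m mi (mK : cancel m mi) (miK : cancel mi m) (c : set nat * set nat) :
  (forall A B : set nat, (exists K, forall i j, K <= i -> d i j -> A i -> B j) ->
    maps_star f (A, B)) ->
  (exists K, forall i j, K <= i -> d i j -> c.1 (m i) -> c.2 (m j)) ->
  maps_star (conj_homeo f (perm_homeo mK miK)) c.
Proof.
move=> fd cd u uc; set h := perm_homeo mK miK.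
rewrite -(homeo_inv_funK h u) conj_homeoE.
rewrite -[h _]/(perm_fun mK _) perm_funE.
apply: (fd (m @^-1` c.1) (m @^-1` c.2)) => //=.
by rewrite -(perm_funE mK) -[perm_fun mK _]/(h _) homeo_inv_funK.
Qed.

Lemma maps_star_sigma (A B : set nat) :
  (exists K, forall i j, K <= i -> j = i.+1 -> A i -> B j) ->
  maps_star sigma (A, B).
Proof.
move=> [K AB] u uA; rewrite -[ultra_sets _ _]/(shift_filter u B) shift_filterE.
have uU := omega_star_ultra u.
have uK := @omega_star_eventually u [set k | K <= k] K (fun k kK => kK).
by apply: filterS (filterI uA uK) => k [Ak Kk]; exact: AB Ak.
Qed.

Lemma maps_star_sigma_inv (A B : set nat) :
  (exists K, forall i j, K <= i -> i = j.+1 -> A i -> B j) ->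
  maps_star ((sigma^-1)%g : homeo omega_star) (A, B).
Proof.
move=> [K AB] u; rewrite -{1}(sigma_invK u).
set v := (X in sigma X); rewrite -[ultra_sets _ _]/(shift_filter v A).
rewrite shift_filterE => vA; have vU := omega_star_ultra v.
have vK := @omega_star_eventually v [set k | K <= k] K (fun k kK => kK).
apply: filterS (filterI vA vK) => k [Ak Kk].
by apply: AB Ak => //; exact: leqW.
Qed.

(** * Meeting a condition in both classes *)

Lemma step_mono p n x y : step p n.+1 x y -> step p n x y.
Proof. by move=> /stepP pxy; apply/stepP => i /ltnW; exact: pxy. Qed.

Lemma step_colour p n a a' b b' : colour p n a = colour p n a' ->
  colour p n b = colour p n b' -> step p n a b -> step p n a' b'.
Proof.
move=> aa' bb' /stepP pab; apply/stepP => i lt_in /(colour1 lt_in aa').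
by move=> /(pab _ lt_in)/(colour2 lt_in bb').
Qed.

Definition finitely_satisfiable (p : nat -> set nat * set nat) :=
  forall n, exists2 g, shift_classes g & forall i, i < n -> maps_star g (p i).

Lemma good_cofinite p n : finite_set (~` good p n).
Proof.
apply: sub_finite_set (finite_small_fibres (colour p n)) => x /=.
by move=> /contrapT.
Qed.

Lemma satisfiable_reach p n x y : finitely_satisfiable p ->
  good p n x -> good p n y -> reach (step p n) (good p n) x y.
Proof.
move=> /(_ n)[g /shift_classes_incompressible gI gp].
exact: step_reach gI gp x y.
Qed.

Lemma sigma_class_satisfies p : finitely_satisfiable p ->
  exists2 g, iso_class sigma g & forall i, maps_star g (p i).
Proof.
move=> pS; have [|n|n x y gx gy F|m [mi [mK miK mE]]] :=
    @path_enumeration (step p) (good p).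
- by move=> n x y; exact: step_mono.
- exact: good_cofinite.
- apply: (@fresh_path _ (colour p n) _ (good p n)) => //.
    by move=> a a' b b'; exact: step_colour.
  exact: satisfiable_reach.
exists (conj_homeo sigma (perm_homeo mK miK)); first exact: isomorphic_conj.
move=> i; apply: maps_star_conj_perm maps_star_sigma _.
(* Stage [i.+1] is the first to test the constraint [p i]. *)
have [K mK'] := mE i.+1; exists K => k _ Kk -> pk.
exact: (stepP _ _ _ _ (mK' k Kk)).
Qed.

(** Strong connectivity survives reversal of edges, and the inverse shift follows the resulting
    enumeration backwards. *)
Lemma sigma_inv_class_satisfies p : finitely_satisfiable p ->
  exists2 g, iso_class (sigma^-1)%g g & forall i, maps_star g (p i).
Proof.
move=> pS; have [|n|n x y gx gy F|m [mi [mK miK mE]]] :=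
    @path_enumeration (fun n x y => step p n y x) (good p).
- by move=> n x y; exact: step_mono.
- exact: good_cofinite.
- apply: (@fresh_path _ (colour p n) _ (good p n)) => //.
    by move=> a a' b b' aa' bb'; exact: step_colour bb' aa'.
  by apply: reach_rev => //; exact: satisfiable_reach.
exists (conj_homeo (sigma^-1)%g (perm_homeo mK miK)).
  exact: isomorphic_conj.
move=> i; apply: maps_star_conj_perm maps_star_sigma_inv _.
(* Here [j] is [k.+1], so the bound [K.+1] on [j] gives [K <= k]. *)
have [K mK'] := mE i.+1; exists K.+1 => j k + jk; rewrite {}jk ltnS => Kk pk.
exact: (stepP _ _ _ _ (mK' k Kk)).
Qed.

(** * Merging conditions; conditions and neighbourhoods *)

Definition satisfies (p : nat -> set nat * set nat) : set (homeo omega_star) :=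
  [set g | forall i, maps_star g (p i)].

(** A number that codes no pair just repeats the entry [q 0 0]. *)
Definition interleave (T : Type) (q : nat -> nat -> T) (k : nat) : T :=
  let ij := odflt (0, 0) (unpickle k) in q ij.1 ij.2.

Lemma satisfies_interleave q g :
  satisfies (interleave q) g <-> forall i, satisfies (q i) g.
Proof.
split=> [gq i j|gq k]; last exact: gq.
by have := gq (pickle (i, j)); rewrite /interleave pickleK.
Qed.

Lemma maps_star_set0 g B : maps_star g (set0, B).
Proof. by move=> u /omega_star_infinite[]; exact: finite_set0. Qed.

(** By compactness, finitely many clopen sets, each sent by [g] into a clopen set inside [O], cover
    [K]; finitely many constraints thus imply a subbasic inclusion. *)
Lemma satisfies_nbhs (g : homeo omega_star) (B : set (homeo omega_star)) :
  nbhs g B -> exists2 s, satisfies s g & satisfies s `<=` B.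
Proof.
pose F := filter_from [set s | satisfies s g] satisfies.
have FF : Filter F.
  apply: filter_from_filter.
    by exists (fun=> (set0, setT)) => n; exact: maps_star_set0.
  move=> s t sg tg; exists (interleave (fun i => if i is 0 then s else t)).
    by apply/satisfies_interleave => -[|i].
  by move=> h /satisfies_interleave st; split; [exact: st 0|exact: st 1].
suff : F --> g by move=> Fg /Fg[s sg sB]; exists s.
apply/homeo_cvgP => K O cK oO gKO.
pose f (c : set nat * set nat) := [set u : omega_star | u c.1 /\
  (maps_star g c /\ forall v : omega_star, v c.2 -> O v)].
have [x Kx|s sP] := compact_finite_cover (f := f) cK.
  have : nbhs (g x) O by apply: open_nbhs_nbhs; split=> //; apply: gKO; exists x.
  move=> /nbhs_omega_star[B' gxB BO].
  have [A xA AB] := omega_star_cvg_nbhs (@continuous_homeo _ g) gxB.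
  by exists (A, B'); apply/nbhs_omega_star; exists A.
(* Entries violated by [g], and indices beyond [s], become the trivial constraint. *)
pose t i := let c := nth (set0, setT) s i in
  if `[< maps_star g c >] then c else (set0, setT).
exists t => [i|h ht _ [x Kx <-]].
  by rewrite /t; case: asboolP => // _; exact: maps_star_set0.
have [c cs [xc [gc cO]]] := sP x Kx.
apply: cO; have := ht (index c s) x; rewrite /t nth_index //.
by case: asboolP => // _; exact.
Qed.

Definition sat p : set (homeo omega_star) := shift_classes `&` satisfies p.

Lemma sat_finitely_satisfiable p : sat p !=set0 -> finitely_satisfiable p.
Proof. by move=> [g [gX gp]] n; exists g => // i _; exact: gp. Qed.

Lemma sat_interleave q i : sat (interleave q) `<=` sat (q i).
Proof. by move=> g [gX /satisfies_interleave gq]; split. Qed.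

(* Countable closure: the limit condition is only finitely satisfied by the
   given homeomorphisms, and the walk provides one that satisfies all of it. *)
Lemma sat_interleave_neq0 q : (forall n, sat (q n.+1) `<=` sat (q n)) ->
  (forall n, sat (q n) !=set0) -> sat (interleave q) !=set0.
Proof.
move=> qS q0.
have [|g gX gq] := @sigma_class_satisfies (interleave q); last first.
  by exists g; split=> //; left.
move=> n; pose fst_code i := (odflt (0, 0) (unpickle i : option (nat * nat))).1.
(* The first [n] entries come from conditions [q j] with [j <= N], so any member of [sat (q N)]
   meets them all. *)
pose N := \max_(i < n) fst_code i.
have [g gN] := q0 N; exists g; first by case: gN.
move=> i lt_in; pose j := fst_code i.
have jN : j <= N by exact: (leq_bigmax (Ordinal lt_in)).
suff [_ gj] : sat (q j) g by exact: gj.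
move: gN; rewrite -(subnKC jN); elim: (N - j) => [|d IHd]; rewrite ?addn0 //.
by rewrite addnS => /qS.
Qed.

(** * Borel sets are decided *)

Definition decided (B : set (homeo omega_star)) : Prop :=
  forall p, sat p !=set0 -> exists q,
    [/\ sat q `<=` sat p, sat q !=set0 & sat q `<=` B \/ sat q `<=` ~` B].

(** If [sat p] meets [B], adding a condition for a neighbourhood inside [B] forces [B]; otherwise
    [p] forces the complement. *)
Lemma decided_open B : open B -> decided B.
Proof.
move=> oB p p0; have [[g [pg Bg]]|N] := pselect (exists g, sat p g /\ B g).
  have [s sg sB] := satisfies_nbhs (open_nbhs_nbhs (conj oB Bg)).
  pose q := interleave (fun i => if i is 0 then p else s).
  exists q; split; first exact: sat_interleave 0.
    exists g; split; first by case: pg.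
    by apply/satisfies_interleave => -[|i] //; case: pg.
  by left=> h /(@sat_interleave _ 1)[_ /sB].
by exists p; split=> //; right=> g pg Bg; apply: N; exists g.
Qed.

Lemma decided_setC B : decided B -> decided (~` B).
Proof.
move=> dB p /dB[q [qp q0 qB]]; exists q; split=> //.
by rewrite setCK; case: qB; [right|left].
Qed.

(** If no extension of [p] forces a single [B n], successive extensions can avoid each [B n] in
    turn; their merger avoids all and is met by countable closure. *)
Lemma decided_bigcup (B : (set (homeo omega_star))^nat) :
  (forall n, decided (B n)) -> decided (\bigcup_n B n).
Proof.
move=> dB p p0.
have [[n [q [qp q0 qB]]]|N] := pselect (exists n q,
    [/\ sat q `<=` sat p, sat q !=set0 & sat q `<=` B n]).
  by exists q; split=> //; left=> g /qB Bg; exists n.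
have /choice[f fP] : forall nq : nat * (nat -> set nat * set nat), exists r,
    sat nq.2 `<=` sat p /\ sat nq.2 !=set0 ->
    [/\ sat r `<=` sat nq.2, sat r !=set0 & sat r `<=` ~` B nq.1].
  move=> [n q] /=; have [[qp q0]|] := pselect (sat q `<=` sat p /\ sat q !=set0).
    have [r [rq r0 [rB|rB]]] := dB n q q0; last by exists r.
    by case: N; exists n, r; split=> //; exact: subset_trans qp.
  by exists q.
pose S := fix S n := if n is n'.+1 then f (n', S n') else p.
have SP n : sat (S n) `<=` sat p /\ sat (S n) !=set0.
  elim: n => [|n IHn]; first by split.
  have [SS S0 _] := fP (n, S n) IHn.
  by split=> //; exact: subset_trans IHn.1.
exists (interleave S); split; first exact: sat_interleave 0.
  apply: sat_interleave_neq0 => n; last by have [] := SP n.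
  by have [] := fP (n, S n) (SP n).
right=> g gS [n _]; have [_ _] := fP (n, S n) (SP n); apply.
exact: (@sat_interleave S n.+1) _ gS.
Qed.

Lemma decided_Borel B : Borel B -> decided B.
Proof.
apply: smallest_sub; last exact: decided_open.
split=> [|A dA|A dA]; first by apply: decided_open; exact: open0.
  by rewrite setTD; exact: decided_setC.
exact: decided_bigcup.
Qed.

Theorem mainTheorem1 :
  ~ exists B : set (homeo omega_star),
      Borel B /\
      ((iso_class sigma `<=` B /\ iso_class (sigma^-1)%g `&` B = set0) \/
       (iso_class (sigma^-1)%g `<=` B /\ iso_class sigma `&` B = set0)).
Proof.
move=> [B [/decided_Borel dB sepB]].
(* Start from the trivial condition, met by [sigma]. The deciding [q] is met in each class, by [g]
   and [h], so [B] contains both or neither. *)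
have [|q [_ /sat_finitely_satisfiable qS qB]] := dB (fun=> (set0, setT)).
  exists sigma; split; first by left; exists 1%g; apply/funext.
  by move=> i; exact: maps_star_set0.
have [g gC gq] := sigma_class_satisfies qS.
have [h hC hq] := sigma_inv_class_satisfies qS.
have sg : sat q g by split=> //; left.
have sh : sat q h by split=> //; right.
case: sepB => -[CB CB0]; case: qB => qB.
- by have : (iso_class (sigma^-1)%g `&` B) h; [split=> //; exact: qB|rewrite CB0].
- by have := qB _ sg; apply; exact: CB.
- by have : (iso_class sigma `&` B) g; [split=> //; exact: qB|rewrite CB0].
- by have := qB _ sh; apply; exact: CB.
Qed.
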